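(* Let $p\in(0,1]$ and $C\in\mathbb{R}$, and put $I(x,1)=\frac{x^2}{2}-\frac{x}{2}+\frac{x}{p}$ for $x\in\{0,1,2,\dots\}$. Consider the single-user Markov decision process with arrival probability $p$ and updating cost $C$ (described in the context), and for $\bar X\in\{1,2,\dots\}$ let $\mathscr{C}(\bar X)$ be the average cost of the threshold-type policy with threshold $\bar X$. For all $x=1,2,\dots$: if $I(x-1,1)\le C<I(x,1)$, then the optimal threshold for minimizing the average cost $\mathscr{C}(\bar X)$ over $\bar X\in\{1,2,\dots\}$, with ties broken in favor of idling, is $\bar X^*=x$.
   Context: Single-user Markov decision process (MDP), in discrete time $t=0,1,2,\dots$. States: $\mathbf{s}(t)=(X(t),\Lambda(t))$ with age $X(t)\in\{1,2,\dots\}$ and arrival indicator $\Lambda(t)\in\{0,1\}$. Actions: $a(t)\in\{0,1\}$, where $1$ means ''update'' and $0$ means ''idle''. Transitions: from state $(x,\lambda)$ under action $a$, the next age is $1$ if $a=\lambda=1$ and is $x+1$ otherwise; independently of the past, the next arrival indicator is $1$ with probability $p$ and $0$ with probability $1-p$. Immediate cost: $C\bigl((x,\lambda),a\bigr)=(x+1-x\,a\,\lambda)+C\,a$, where the real number $C$ is the updating cost. Average cost of a policy $\mu$ (a rule specifying the action in each slot): $\limsup_{T\to\infty}\frac{1}{T+1}E_\mu\left[\sum_{t=0}^{T}C(\mathbf{s}(t),a(t))\right]$, where $E_\mu$ is the expectation when $\mu$ is employed. The threshold-type policy with threshold $\bar X\in\{1,2,\dots\}$ is the stationary deterministic policy whose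 action in state $(x,\lambda)$ is to update if $\lambda=1$ and $x\ge\bar X$, and to idle otherwise. Tie-breaking in favor of idling: if several thresholds minimize the average cost, the optimal threshold is taken to be the largest of them. For $x\ge 1$, $I(x,1)$ is the Whittle index of state $(x,1)$; the value $I(0,1)=0$ is given by the same formula. *)

(* Defs.v *)
From mathcomp Require Import all_boot all_order all_algebra.
From mathcomp Require Import all_classical all_reals all_analysis.

Set Implicit Arguments.
Unset Strict Implicit.
Unset Printing Implicit Defensive.

Import Order.TTheory GRing.Theory Num.Theory.
Local Open Scope classical_set_scope.
Local Open Scope ring_scope.

(* State (x, l): age x and arrival indicator l. Ages range over {1, 2, ...};
   this is an invariant of [next_age] once the initial age is positive. *)
Definition state : Type := (nat * bool)%type.

(* [true] is "update", [false] is "idle". *)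
Definition action : Type := bool.

Definition next_age (s : state) (a : action) : nat :=
  if a && s.2 then 1%N else s.1.+1.

Definition stage_cost (R : realType) (C : R) (s : state) (a : action) : R :=
  (s.1%:R + 1 - s.1%:R * a%:R * s.2%:R) + C * a%:R.

(* A policy selects the action from the past states s(0), ..., s(t-1) and the
   current state s(t); past actions are functions of the past states. *)
Definition policy : Type := seq state -> state -> action.

Definition threshold_policy (Xbar : nat) : policy :=
  fun _ s => s.2 && (Xbar <= s.1)%N.

(* The past states and the current state at time t under [mu], along the
   arrival sequence [arr] and from initial age [x0]. *)
Fixpoint history (mu : policy) (x0 : nat) (arr : nat -> bool) (t : nat) :
    seq state * state :=
  if t is u.+1 then
    let: (h, s) := history mu x0 arr u in
    (rcons h s, (next_age s (mu h s), arr t))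
  else ([::], (x0, arr 0%N)).

Definition state_at (mu : policy) (x0 : nat) (arr : nat -> bool) (t : nat) :
    state := (history mu x0 arr t).2.

Definition action_at (mu : policy) (x0 : nat) (arr : nat -> bool) (t : nat) :
    action :=
  let: (h, s) := history mu x0 arr t in mu h s.

(* Given L(0), ..., L(t), the indicator L(t+1) is Bernoulli(p). The law of L(0),
   i.e. of the initial arrival indicator, is left arbitrary. The randomness of
   the process comes only from the arrivals, so the past up to time t is a
   function of L(0), ..., L(t). *)
Definition arrival_process (R : realType) (p : R) (d : measure_display)
    (T : measurableType d) (P : probability T R)
    (L : nat -> {RV P >-> bool}) : Prop :=
  forall (t : nat) (b : nat -> bool),
    P [set w | forall i : nat, (i <= t.+1)%N -> L i w = b i] =
    (P [set w | forall i : nat, (i <= t)%N -> L i w = b i] *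
     (if b t.+1 then p else 1 - p)%R%:E)%E.

Definition average_cost (R : realType) (C : R) (d : measure_display)
    (T : measurableType d) (P : probability T R)
    (L : nat -> {RV P >-> bool}) (x0 : nat) (mu : policy) : \bar R :=
  limn_esup (fun n : nat =>
    ((n.+1%:R^-1)%R%:E *
     'E_P[fun w => (\sum_(0 <= t < n.+1)
            stage_cost C (state_at mu x0 (fun i => L i w) t)
                         (action_at mu x0 (fun i => L i w) t))%R])%E).

(* The Whittle index I(x, 1), extended by the same formula to x = 0. *)
Definition whittle_index (R : realType) (p : R) (x : nat) : R :=
  x%:R ^+ 2 / 2 - x%:R / 2 + x%:R / p.

Definition minimizing_threshold (R : realType) (J : nat -> \bar R) (X : nat) :
    Prop :=
  (1 <= X)%N /\ forall Y : nat, (1 <= Y)%N -> (J X <= J Y)%E.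

(* Ties are broken in favor of idling: the largest minimizing threshold. *)
Definition optimal_threshold (R : realType) (J : nat -> \bar R) (X : nat) :
    Prop :=
  minimizing_threshold J X /\
  forall Y : nat, minimizing_threshold J Y -> (Y <= X)%N.

(* Main.v *)
(* Under the threshold Y the ages split into renewal cycles of length
   N = Y - 1 + G with G geometric of parameter p, and a cycle costs
   N (N + 1) / 2 + C. Hence the average cost is the ratio of expectations
   renewal_cost Y, and renewal_cost (Y + 1) - renewal_cost Y has the sign of
   I(Y, 1) - C; as I is increasing, the minimum and its ties are located by
   comparing C with I.

   The ergodic statement is obtained without renewal theory: renewal_cost Y and
   an explicit function "bias" of the age solve the Poisson equation of the age
   chain, so the expected total cost telescopes up to an expectation of the
   bias. The bias grows linearly and the expected age is bounded because
   e(t + 1) <= (1 - p) e(t) + Y + 1. *)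

Require Import Defs.
From mathcomp Require Import all_boot all_order all_algebra.
From mathcomp Require Import all_classical all_reals all_analysis.
From mathcomp Require Import ring lra.

Set Implicit Arguments.
Unset Strict Implicit.
Unset Printing Implicit Defensive.

Import Order.TTheory GRing.Theory Num.Theory.
Local Open Scope classical_set_scope.
Local Open Scope ring_scope.

(** * Functions of finitely many arrivals and their expectations *)

Definition cylinder (T : Type) (L : nat -> T -> bool) (t : nat)
    (b : nat -> bool) : set T :=
  [set w | forall i, (i <= t)%N -> L i w = b i]%classic.

Definition determined_by (t : nat) (U : Type) (f : (nat -> bool) -> U) : Prop :=
  forall a b, (forall i, (i <= t)%N -> a i = b i) -> f a = f b.

(** Each [w] lies in exactly one of the finitely many cylinders of depth [t]. Hence [f] becomes a
    simple function of [w]: it is integrable, and its expectation is a finite sum of cylinder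
    probabilities, which [arrival_process] controls. *)
Lemma determined_by_cylinders (R : realType) (T : Type) (L : nat -> T -> bool)
    (t : nat) (f : (nat -> bool) -> R) (w : T) :
  determined_by t f ->
  f (L ^~ w) = \sum_(b : t.+1.-tuple bool)
                 f (nth false b) * \1_(cylinder L t (nth false b)) w.
Proof.
move=> ft; pose b0 := [tuple L (i : 'I_t.+1) w | i < t.+1].
have b0E i : (i <= t)%N -> nth false b0 i = L i w.
  move=> it; have it' : (i < t.+1)%N by [].
  by rewrite -(tnth_nth false b0 (Ordinal it')) tnth_mktuple.
rewrite (bigD1 b0) //= big1 => [|b bb0].
  rewrite addr0 indicE mem_set ?mulr1; first last.
    by move=> i it; rewrite b0E.
  by apply: ft => i it; rewrite b0E.
rewrite indicE memNset ?mulr0 //= => H; case/negP: bb0; apply/eqP.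
apply: eq_from_tnth => i; rewrite tnth_mktuple (tnth_nth false) -H //.
by rewrite -ltnS.
Qed.

Section Arrivals.
Context {R : realType} {d : measure_display} {T : measurableType d}.
Context {P : probability T R} {L : nat -> {RV P >-> bool}}.

Lemma cylinder_measurable t b : measurable (cylinder L t b).
Proof.
have -> : cylinder L t b =
    (\bigcap_(i in [set i | (i <= t)%N]) (L i @^-1` [set b i]))%classic.
  by apply/seteqP; split.
apply: bigcap_measurableType => i _.
by rewrite -[X in measurable X]setTI; apply: measurable_funP.
Qed.

Lemma integrable_determined t (f : (nat -> bool) -> R) :
  determined_by t f -> P.-integrable setT (fun w => (f (L ^~ w))%:E).
Proof.
move=> ft.
under [X in _.-integrable _ X]eq_fun => w do
  rewrite (determined_by_cylinders (fun i => L i) w ft) -sumEFin.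
apply: integrable_sum => // b _.
under eq_fun do rewrite EFinM.
apply: integrableZl => //; apply: integrable_indic.
exact: cylinder_measurable.
Qed.

Lemma Rintegral_cylinders (I : finType) (c : I -> R) (S : I -> set T) :
  (forall i, measurable (S i)) ->
  \int[P]_w (\sum_i c i * \1_(S i) w) = \sum_i c i * fine (P (S i)).
Proof.
move=> mS; rewrite /Rintegral.
have iS i : P.-integrable setT (fun w => (c i * \1_(S i) w)%:E).
  under eq_fun do rewrite EFinM.
  by apply: integrableZl => //; apply: integrable_indic.
under eq_integral do rewrite -sumEFin.
rewrite integral_sum //= -sum_fine => [|i _]; last exact: integrable_fin_num.
apply: eq_bigr => i _.
under eq_integral do rewrite EFinM.
rewrite integralZl //; last exact: integrable_indic.
by rewrite integral_indic // setIT fineM //; exact: fin_num_measure.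
Qed.

(** This is the independence of the next arrival from the past. Multiplying by the indicator of
    [L t.+1] shrinks each cylinder of depth [t] to one of depth [t.+1], and [arrival_process] gives
    the factor [p]. *)
Lemma Rintegral_arrival (p : R) t (f : (nat -> bool) -> R) :
  arrival_process p L -> determined_by t f ->
  \int[P]_w (f (L ^~ w) * (L t.+1 w)%:R) = p * \int[P]_w f (L ^~ w).
Proof.
move=> hL ft.
(* [b' b] prolongs the arrival pattern [b] by an arrival in slot [t.+1]. *)
pose b' (b : t.+1.-tuple bool) i := if i == t.+1 then true else nth false b i.
have cylE b w : \1_(cylinder L t (nth false (b : t.+1.-tuple bool))) w *
    (L t.+1 w)%:R = \1_(cylinder L t.+1 (b' b)) w :> R.
  rewrite !indicE; have [Lt|Lt] := boolP (L t.+1 w).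
    rewrite mulr1; congr (_%:R); congr nat_of_bool.
    apply/idP/idP => /set_mem H; apply/mem_set => i /=.
      rewrite leq_eqVlt /b' => /predU1P[->|it]; first by rewrite eqxx.
      by rewrite ltn_eqF // H.
    by move=> it; rewrite (H i) 1?leqW // /b' ltn_eqF.
  rewrite mulr0 memNset // => /(_ _ (leqnn _)).
  by rewrite /b' eqxx => /= Lt'; rewrite Lt' in Lt.
transitivity (\int[P]_w \sum_(b : t.+1.-tuple bool)
    f (nth false b) * \1_(cylinder L t.+1 (b' b)) w).
  apply: eq_Rintegral => w _.
  rewrite (determined_by_cylinders (fun i => L i) w ft) mulr_suml.
  by apply: eq_bigr => b _; rewrite -mulrA cylE.
rewrite [in RHS](_ : \int[P]_w _ = \int[P]_w \sum_(b : t.+1.-tuple bool)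
    f (nth false b) * \1_(cylinder L t (nth false b)) w); last first.
  by apply: eq_Rintegral => w _; exact: determined_by_cylinders.
rewrite !Rintegral_cylinders => [|b|b]; try exact: cylinder_measurable.
rewrite mulr_sumr; apply: eq_bigr => b _; rewrite mulrCA; congr (_ * _).
rewrite /cylinder hL {2}/b' eqxx.
have -> : [set w | forall i, (i <= t)%N -> L i w = b' b i]%classic =
    cylinder L t (nth false b).
  apply/seteqP; split => w /= H i it; rewrite H //.
    by rewrite /b' ltn_eqF.
  by rewrite /b' ltn_eqF.
have Pfin := fin_num_measure P _ (@cylinder_measurable t (nth false b)).
by rewrite (fineM Pfin) // [RHS]mulrC.
Qed.

End Arrivals.

(** * The renewal cost as a function of the threshold, and the Poisson equation *)

Section RenewalCost.
Context {R : realType} (p C : R).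
Context (p_gt0 : 0 < p).

(* With G geometric: E N = Y - 1 + 1/p and
   E (N (N + 1) / 2) = Y (Y - 1) / 2 + (Y - 1) / p + 1 / p^2. *)
Definition renewal_cost (Y : nat) : R :=
  (Y%:R * (Y%:R - 1) / 2 + (Y%:R - 1) / p + p ^- 2 + C) / (Y%:R - 1 + p^-1).

Lemma cycle_length_gt0 (Y : nat) : (1 <= Y)%N -> 0 < Y%:R - 1 + p^-1.
Proof.
move=> Y1; apply: ltr_wpDl; last by rewrite invr_gt0.
by rewrite subr_ge0 ler1n.
Qed.

Lemma renewal_costS_sub (Y : nat) : (1 <= Y)%N ->
  renewal_cost Y.+1 - renewal_cost Y = (whittle_index p Y - C) /
    ((Y.+1%:R - 1 + p^-1) * (Y%:R - 1 + p^-1)).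
Proof.
move=> Y1; have hY := cycle_length_gt0 Y1.
have hS : 0 < Y.+1%:R - 1 + p^-1 by apply: cycle_length_gt0.
have p0 : p != 0 by rewrite gt_eqF.
(* The denominators that [field] wants nonzero are [p] times a cycle length. *)
have side (y : R) : 0 < y - 1 + p^-1 -> (y - 1) * p + 1 != 0.
  move=> y0; have -> : (y - 1) * p + 1 = p * (y - 1 + p^-1) by field.
  by rewrite mulf_neq0 // gt_eqF.
rewrite /renewal_cost /whittle_index -natr1 in hS *.
by field; rewrite p0 !side.
Qed.

Lemma whittle_index_increasing :
  {homo whittle_index p : m n / (m < n)%N >-> m < n}.
Proof.
apply: homo_ltn => [y x z|n]; first exact: lt_trans.
rewrite -subr_gt0 /whittle_index -natr1.
have -> : (n%:R + 1) ^+ 2 / 2 - (n%:R + 1) / 2 + (n%:R + 1) / p -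
  (n%:R ^+ 2 / 2 - n%:R / 2 + n%:R / p) =
    n%:R + p^-1 :> R by field; rewrite gt_eqF.
by rewrite ltr_wpDl // invr_gt0.
Qed.

(** Every increment from [x] on has the sign of I(Y, 1) - C >= I(x, 1) - C > 0. The strictness
    excludes ties above [x]. *)
Lemma renewal_cost_increasing (x Y : nat) :
  (1 <= x)%N -> C < whittle_index p x -> (x < Y)%N ->
  renewal_cost x < renewal_cost Y.
Proof.
move=> x1 Cx; elim: Y => // Y IH; rewrite ltnS => xY.
have Y1 := leq_trans x1 xY.
suff lt : renewal_cost Y < renewal_cost Y.+1.
  by move: xY; rewrite leq_eqVlt => /predU1P[->//|/IH/lt_trans]; apply.
rewrite -subr_gt0 renewal_costS_sub // divr_gt0 //.
  rewrite subr_gt0 (lt_le_trans Cx) //.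
  move: xY; rewrite leq_eqVlt => /predU1P[->//|].
  by move/whittle_index_increasing/ltW.
by rewrite mulr_gt0 ?cycle_length_gt0.
Qed.

(** Increments below [x] involve indices at most I(x - 1, 1) <= C. Equality may occur, which is
    harmless since ties go to the larger threshold. *)
Lemma renewal_cost_nonincreasing (x Y : nat) :
  (1 <= Y)%N -> (Y <= x)%N -> whittle_index p x.-1 <= C ->
  renewal_cost x <= renewal_cost Y.
Proof.
move=> Y1; elim: x => [|x IH]; first by rewrite leqn0 => /eqP ->.
rewrite leq_eqVlt => /predU1P[->//|]; rewrite ltnS /= => Yx xC.
have x1 := leq_trans Y1 Yx.
suff le : renewal_cost x.+1 <= renewal_cost x.
  apply: (le_trans le); apply: IH => //; apply: le_trans xC.
  by apply/ltW/whittle_index_increasing; rewrite prednK.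
rewrite -subr_le0 renewal_costS_sub // pmulr_lle0 ?subr_le0 //.
by rewrite invr_gt0 mulr_gt0 ?cycle_length_gt0.
Qed.

(* Normalised by bias Y 1 = 0; the two branches agree at x = Y by the choice of
   renewal_cost Y. *)
Definition bias (Y x : nat) : R :=
  if (x < Y)%N then (x%:R - 1) * renewal_cost Y - x%:R * (x%:R + 1) / 2 + 1
  else (1 - p) / p * x%:R +
       ((1 - p) ^+ 2 / p + 1 + p * C - renewal_cost Y) / p.

(** Including [x = Y] matters for the Poisson equation at age Y - 1, whose successor is Y. *)
Lemma bias_le_threshold (Y x : nat) : (1 <= Y)%N -> (x <= Y)%N ->
  bias Y x = (x%:R - 1) * renewal_cost Y - x%:R * (x%:R + 1) / 2 + 1.
Proof.
move=> Y1; rewrite /bias leq_eqVlt => /predU1P[->|->//]; rewrite ltnn.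
have hY := cycle_length_gt0 Y1.
have p0 : p != 0 by rewrite gt_eqF.
have e : (Y%:R - 1) * p + 1 = p * (Y%:R - 1 + p^-1) by field.
by rewrite /renewal_cost; field; rewrite p0 e mulf_neq0 // gt_eqF.
Qed.

(** The left side is the expected stage cost plus bias of the next age, given age [x]. Below Y this
    reduces to the recursion bias(x + 1) - bias(x) = J - (x + 1) with J the renewal cost; from Y on,
    an affine bias solves it. *)
Lemma poisson_equation (Y x : nat) : (1 <= Y)%N -> (1 <= x)%N ->
  x%:R + 1 + bias Y x.+1 +
    p * ((Y <= x)%N%:R * (C - x%:R + bias Y 1 - bias Y x.+1)) =
  renewal_cost Y + bias Y x.
Proof.
move=> Y1 x1; rewrite (@bias_le_threshold _ 1%N) //.
have p0 : p != 0 by rewrite gt_eqF.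
case: (leqP Y x) => [Yx|xY].
  by rewrite /bias !ltnNge Yx (leq_trans Yx) //= -natr1; field.
by rewrite !bias_le_threshold // 1?ltnW //= -natr1; field.
Qed.

Lemma bias_linear_growth (Y : nat) :
  exists G : R, forall x, (1 <= x)%N -> `|bias Y x| <= G * x%:R.
Proof.
pose J := renewal_cost Y; pose A := (1 - p) / p.
pose B := ((1 - p) ^+ 2 / p + 1 + p * C - J) / p.
(* Below Y the quadratic term is linear in disguise, since x + 1 <= Y; from Y on, [|B|] is absorbed
   using 1 <= x. The facts [h1], [h2], ... supply the products that [lra] cannot form. *)
exists (`|J| + Y%:R + 1 + `|A| + `|B|) => x x1.
have hx : 1 <= x%:R :> R by rewrite ler1n.
have Y0 : 0 <= Y%:R :> R by [].
rewrite /bias -/J -/A -/B; case: ifP => [xY|_].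
  have xY' : x%:R + 1 <= Y%:R :> R by rewrite natr1 ler_nat.
  have h1 : 0 <= (x%:R - 1) * (`|J| - J).
    by rewrite mulr_ge0 ?subr_ge0 ?ler_norm.
  have h2 : 0 <= (x%:R - 1) * (`|J| + J).
    by rewrite mulr_ge0 ?subr_ge0 // addrC -lerBlDr sub0r lerNnormlW.
  have h3 : 0 <= x%:R * (Y%:R - (x%:R + 1)) :> R by rewrite mulr_ge0 ?subr_ge0.
  have h4 : 0 <= x%:R * x%:R :> R by rewrite mulr_ge0.
  have h5 : 0 <= `|A| * x%:R by rewrite mulr_ge0.
  have h6 : 0 <= `|B| * x%:R by rewrite mulr_ge0.
  have h7 := normr_ge0 J.
  rewrite ler_norml; apply/andP; split; lra.
have h1 : 0 <= x%:R * (`|A| - A) by rewrite mulr_ge0 ?subr_ge0 ?ler_norm.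
have h2 : 0 <= x%:R * (`|A| + A).
  by rewrite mulr_ge0 // addrC -lerBlDr sub0r lerNnormlW.
have h3 : 0 <= (x%:R - 1) * `|B| by rewrite mulr_ge0 ?subr_ge0.
have h4 : 0 <= `|B| - B by rewrite subr_ge0 ler_norm.
have h5 : 0 <= `|B| + B by rewrite addrC -lerBlDr sub0r lerNnormlW.
have h6 : 0 <= `|J| * x%:R by rewrite mulr_ge0.
have h7 : 0 <= Y%:R * x%:R :> R by rewrite mulr_ge0.
rewrite ler_norml; apply/andP; split; lra.
Qed.

End RenewalCost.

(** * Closure properties of [determined_by], and expectations of constants *)

Lemma determined_by_comp2 (U V W : Type) t (h : U -> V -> W)
    (f : (nat -> bool) -> U) (g : (nat -> bool) -> V) :
  determined_by t f -> determined_by t g ->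
  determined_by t (fun a => h (f a) (g a)).
Proof. by move=> ft gt a b ab; rewrite (ft a b) // (gt a b). Qed.

Lemma determined_by_comp (U V : Type) t (h : U -> V) (f : (nat -> bool) -> U) :
  determined_by t f -> determined_by t (h \o f).
Proof. by move=> ft a b ab /=; rewrite (ft a b). Qed.

Lemma determined_byW (U : Type) s t (f : (nat -> bool) -> U) :
  (s <= t)%N -> determined_by s f -> determined_by t f.
Proof. by move=> st fs a b ab; apply: fs => i /leq_trans/(_ st); exact: ab. Qed.

Lemma Rintegral_cst_probability (R : realType) d (T : measurableType d)
    (P : probability T R) (r : R) : \int[P]_w r = r.
Proof.
rewrite Rintegral_cst // -[RHS]mulr1; congr (_ * _).
exact: (congr1 fine (probability_setT P)).
Qed.

(** * The age chain under a threshold policy *)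

Section ThresholdPolicy.
Context (Y x0 : nat).
Local Notation mu := (threshold_policy Y).

Definition age (t : nat) (arr : nat -> bool) : nat := (state_at mu x0 arr t).1.

Lemma arrival_indicator_at arr t : (state_at mu x0 arr t).2 = arr t.
Proof. by rewrite /state_at; case: t => //= t; case: history. Qed.

Lemma action_atE arr t : action_at mu x0 arr t = arr t && (Y <= age t arr)%N.
Proof.
rewrite -(arrival_indicator_at arr t) /age /action_at /state_at.
by case: history => h [].
Qed.

Lemma ageS arr t :
  age t.+1 arr = if arr t && (Y <= age t arr)%N then 1%N else (age t arr).+1.
Proof.
rewrite -action_atE -[in RHS](andbT (action_at _ _ _ _)).
rewrite /age /state_at /action_at /=.
have := arrival_indicator_at arr t; rewrite /state_at.
case: history => h [y l] /= ->.
by rewrite /next_age /threshold_policy /= andbT; case: (arr t); rewrite ?andbT.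
Qed.

Lemma age_gt0 t arr : (0 < x0)%N -> (0 < age t arr)%N.
Proof. by case: t => // t _; rewrite ageS; case: ifP. Qed.

(** The lag of one slot is essential: the age at [t.+1] is settled before the arrival of slot
    [t.+1], so [Rintegral_arrival] applies to functions of it. *)
Lemma age_determined t : determined_by t (age t.+1).
Proof.
elim: t => [|t IH] a b ab; rewrite ageS [RHS]ageS; first by rewrite ab.
by rewrite ab // (IH a b) // => i it; rewrite ab // leqW.
Qed.

Lemma state_at_determined t : determined_by t (fun a => state_at mu x0 a t).
Proof.
move=> a b ab; rewrite [LHS]surjective_pairing [RHS]surjective_pairing.
rewrite !arrival_indicator_at ab //; congr pair; case: t ab => // t ab.
by apply: age_determined => i it; rewrite ab // leqW.
Qed.

(** * Expected costs and the average cost *)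

Context {R : realType} (p C : R) (p_gt0 : 0 < p) (p_le1 : p <= 1).
Context {d : measure_display} {T : measurableType d}.
Context {P : probability T R} {L : nat -> {RV P >-> bool}}.
Context (hL : arrival_process p L) (Y_gt0 : (0 < Y)%N) (x0_gt0 : (0 < x0)%N).

Local Notation E f := (\int[P]_w (f (L ^~ w : nat -> bool))).

Definition cost_at (t : nat) (arr : nat -> bool) : R :=
  stage_cost C (state_at mu x0 arr t) (action_at mu x0 arr t).

(** This form is affine in the arrival indicator, as [expectation_transition] requires. *)
Lemma cost_atE t arr :
  cost_at t arr = (age t arr)%:R + 1 +
    (Y <= age t arr)%N%:R * (C - (age t arr)%:R) * (arr t)%:R.
Proof.
rewrite /cost_at /stage_cost arrival_indicator_at action_atE -/(age t arr).
by case: (arr t); case: leqP => _ /=; ring.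
Qed.

Lemma cost_at_determined t : determined_by t (cost_at t).
Proof.
move=> a b ab; rewrite /cost_at !action_atE /age.
by rewrite (state_at_determined ab) ab.
Qed.

(** Every function of the age and a bit is affine in the bit, so this computes all one-step
    expectations. Slot 0 is left out because the law of its arrival is arbitrary. *)
Lemma expectation_transition (h : nat -> R) (g : nat -> R) t :
  E (fun a => h (age t.+1 a) + g (age t.+1 a) * (a t.+1)%:R) =
  E (fun a => h (age t.+1 a) + p * g (age t.+1 a)).
Proof.
have dh := determined_by_comp h (@age_determined t).
have dg := determined_by_comp g (@age_determined t).
have dr : determined_by t.+1 (fun a => a t.+1) by move=> a b; apply.
have dga : determined_by t.+1 (fun a => g (age t.+1 a) * (a t.+1)%:R).
  by apply: (determined_by_comp2 (fun u v => u * (v : bool)%:R)) dr;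
     exact: determined_byW dg.
rewrite !RintegralD //.
- rewrite (Rintegral_arrival hL dg) RintegralZl //.
  exact: integrable_determined dg.
- exact: integrable_determined dh.
- exact: (integrable_determined (determined_by_comp ( *%R p) dg)).
- exact: integrable_determined dh.
- exact: integrable_determined dga.
Qed.

Lemma expected_cost t :
  E (cost_at t.+1) = renewal_cost p C Y + E (bias p C Y \o age t.+1)
                     - E (bias p C Y \o age t.+2).
Proof.
have db s := integrable_determined (P := P) (L := L)
  (determined_by_comp (bias p C Y) (@age_determined s)).
have dc := integrable_determined (P := P) (L := L) (@cost_at_determined t.+1).
apply/eqP; rewrite eq_sym subr_eq eq_sym; apply/eqP.
rewrite -RintegralD //; last exact: (db t.+1).
(* [h] is the cost plus next bias without an arrival, and [g] is the correction due to an
   arrival. *)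
pose h y : R := y%:R + 1 + bias p C Y y.+1.
pose g y : R := (Y <= y)%N%:R * (C - y%:R + bias p C Y 1 - bias p C Y y.+1).
transitivity (E (fun a => h (age t.+1 a) + g (age t.+1 a) * (a t.+1)%:R)).
  apply: eq_Rintegral => w _ /=; rewrite cost_atE (ageS _ t.+1) /h /g.
  by case: (L t.+1 w); case: leqP => _ /=; ring.
rewrite expectation_transition.
transitivity (E (fun a => renewal_cost p C Y + bias p C Y (age t.+1 a))).
  apply: eq_Rintegral => w _; rewrite /h /g poisson_equation //.
  exact: age_gt0.
rewrite RintegralD //; first last.
- exact: (db t).
- exact: (integrable_determined (determined_by_comp
    (fun=> renewal_cost p C Y) (@age_determined t))).
by rewrite Rintegral_cst_probability.
Qed.

Lemma expected_age_bounded :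
  exists K : R, forall t, E (fun a => (age t.+1 a)%:R) <= K.
Proof.
have da s := integrable_determined (P := P) (L := L)
  (determined_by_comp (fun n => n%:R : R) (@age_determined s)).
(* (Y + 1) / p is the fixed point of e = (1 - p) e + Y + 1; the other term covers the initial
   value. *)
exists (E (fun a => (age 1 a)%:R) + (Y%:R + 1) / p) => t.
have E0 : 0 <= E (fun a => (age 1 a)%:R) by apply: Rintegral_ge0.
have Yp : 0 <= (Y%:R + 1) / p by rewrite divr_ge0 ?addr_ge0 // ltW.
elim: t => [|t IH]; first by rewrite lerDl.
pose h y : R := y%:R + 1.
pose g y : R := - ((Y <= y)%N%:R * y%:R).
have -> : E (fun a => (age t.+2 a)%:R) =
    E (fun a => h (age t.+1 a) + g (age t.+1 a) * (a t.+1)%:R).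
  apply: eq_Rintegral => w _ /=; rewrite (ageS _ t.+1) /h /g.
  by case: (L t.+1 w); case: leqP => _ /=; rewrite -?natr1; ring.
rewrite expectation_transition.
have dr : P.-integrable setT
    (fun w => ((1 - p) * (age t.+1 (L ^~ w))%:R + (Y%:R + 1))%:E).
  exact: (integrable_determined (determined_by_comp
    (fun n => (1 - p) * n%:R + (Y%:R + 1)) (@age_determined t))).
apply: (@le_trans _ _ (E (fun a => (1 - p) * (age t.+1 a)%:R + (Y%:R + 1)))).
  apply: le_Rintegral => // [|w _].
    exact: (integrable_determined (determined_by_comp
      (fun n => h n + p * g n) (@age_determined t))).
  rewrite /h /g; set y := age _ _.
  have [Y0 y0] : 0 <= Y%:R :> R /\ 0 <= y%:R :> R by [].
  (* For y >= Y the left side is (1 - p) y + 1; for y < Y it is y + 1, and p y <= y <= Y. *)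
  case: (leqP Y y) => [_|/ltnW]; first by rewrite mul1r; lra.
  rewrite -(ler_nat R) mul0r => yY.
  have := ler_piMl y0 p_le1; lra.
rewrite RintegralD //.
- rewrite RintegralZl //; last exact: (da t).
  rewrite Rintegral_cst_probability.
  have pK : (Y%:R + 1) / p * p = Y%:R + 1 by rewrite divfK // gt_eqF.
  have q0 : 0 <= 1 - p by rewrite subr_ge0.
  apply: le_trans (lerD (ler_wpM2l q0 IH) (lexx _)) _.
  have := mulr_ge0 (ltW p_gt0) E0; move: pK; lra.
- exact: (integrable_determined (determined_by_comp
    (fun n => (1 - p) * n%:R) (@age_determined t))).
- exact: (integrable_determined (determined_by_comp
    (fun=> Y%:R + 1) (@age_determined t))).
Qed.

Lemma expected_bias_bounded :
  exists M : R, forall t, `|E (bias p C Y \o age t.+1)| <= M.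
Proof.
have [G hG] := bias_linear_growth p C Y.
have [K hK] := expected_age_bounded.
have G0 : 0 <= G by have := hG 1%N isT; rewrite mulr1; apply: le_trans.
have db s := integrable_determined (P := P) (L := L)
  (determined_by_comp (bias p C Y) (@age_determined s)).
exists (G * K) => t; apply: le_trans (ler_wpM2l G0 (hK t)).
apply: le_trans (le_normr_Rintegral _ (db t)) _ => //.
rewrite -RintegralZl //; last exact: (integrable_determined
  (determined_by_comp (fun n => n%:R) (@age_determined t))).
apply: le_Rintegral => //.
- exact: (integrable_determined (determined_by_comp
    (fun n => `|bias p C Y n|) (@age_determined t))).
- exact: (integrable_determined (determined_by_comp
    (fun n => G * n%:R) (@age_determined t))).
by move=> w _; apply/hG/age_gt0.
Qed.

(** Slot 0 is kept apart, and [expected_cost] telescopes over the remaining [n] slots. *)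
Lemma expected_total_cost n :
  'E_P[fun w => (\sum_(0 <= t < n.+1) cost_at t (L ^~ w))%R]%E =
  (E (cost_at 0) + n%:R * renewal_cost p C Y + E (bias p C Y \o age 1)
   - E (bias p C Y \o age n.+1))%:E.
Proof.
have ic t := integrable_determined (P := P) (L := L) (@cost_at_determined t).
rewrite unlock; under eq_integral do rewrite -sumEFin.
rewrite integral_sum //.
under eq_bigr do rewrite -(fineK (integrable_fin_num measurableT (ic _))).
rewrite sumEFin; congr EFin.
elim: n => [|n IH]; first by rewrite big_nat1 mul0r addr0 addrK.
rewrite big_nat_recr //= IH.
have := expected_cost n; rewrite /Rintegral => ->.
rewrite -natr1; ring.
Qed.

Lemma average_costE :
  average_cost C L x0 mu = (renewal_cost p C Y)%:E.
Proof.
have [M hM] := expected_bias_bounded.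
pose J := renewal_cost p C Y.
pose b n := E (bias p C Y \o age n.+1).
pose c := E (cost_at 0).
have -> : average_cost C L x0 mu = limn_esup (fun n =>
    (harmonic n * (c + n%:R * J + b 0%N - b n))%:E).
  rewrite /average_cost; congr limn_esup; apply/funext => n.
  by rewrite expected_total_cost.
(* Since n J = (n + 1) J - J and [harmonic n] is 1 / (n + 1), the average deviates from J by
   [harmonic n] times a bounded quantity. *)
pose e n := harmonic n * (`|c - J + b 0%N| + M).
have bound n : J - e n <= harmonic n * (c + n%:R * J + b 0%N - b n) <= J + e n.
  have n1 : n.+1%:R != 0 :> R by rewrite pnatr_eq0.
  have -> : harmonic n * (c + n%:R * J + b 0%N - b n) =
      J + harmonic n * (c - J + b 0%N - b n).
    rewrite /harmonic /= -natr1 in n1 *.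
    by move: (b n) (b 0%N) => b1 b0; field.
  rewrite -ler_distl addrAC subrr add0r normrM ger0_norm ?harmonic_ge0 //.
  rewrite ler_wpM2l ?harmonic_ge0 //.
  by apply: le_trans (ler_normB _ _) _; rewrite lerD2l; exact: hM.
have e0 : e @ \oo --> (0 : R^o).
  rewrite -(mul0r (`|c - J + b 0%N| + M)).
  by apply: cvgMl; exact: cvg_harmonic.
suff u_cvg : (fun n => harmonic n * (c + n%:R * J + b 0%N - b n)) @ \oo
    --> (J : R^o).
  by apply: (snd (cvg_limn_einf_sup _)); apply: cvg_EFin => //; exact: nearW.
apply: (@squeeze_cvgr _ _ _ _ (fun n => J - e n) (fun n => J + e n)).
- exact: nearW.
- by rewrite -[X in _ --> X]subr0; apply: cvgB => //; exact: cvg_cst.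
- by rewrite -[X in _ --> X]addr0; apply: cvgD => //; exact: cvg_cst.
Qed.

End ThresholdPolicy.

(** * Optimality of the threshold *)

Theorem theorem8 (R : realType) (p C : R) (hp0 : 0 < p) (hp1 : p <= 1)
    (d : measure_display) (T : measurableType d) (P : probability T R)
    (L : nat -> {RV P >-> bool}) (hL : arrival_process p L)
    (x0 : nat) (hx0 : (1 <= x0)%N)
    (x : nat) (hx : (1 <= x)%N)
    (hlo : whittle_index p x.-1 <= C) (hhi : C < whittle_index p x) :
  optimal_threshold
    (fun Xbar : nat => average_cost C L x0 (threshold_policy Xbar)) x.
Proof.
have costE Y : (1 <= Y)%N ->
    average_cost C L x0 (threshold_policy Y) = (renewal_cost p C Y)%:E.
  by move=> Y1; exact: average_costE.
split=> [|Y [Y1 /(_ x hx)]].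
  split=> // Y Y1; rewrite !costE // lee_fin.
  case: (leqP Y x) => [Yx|xY]; first exact: renewal_cost_nonincreasing.
  exact/ltW/renewal_cost_increasing.
(* A minimizer above [x] would contradict the strict increase of the renewal cost there. *)
rewrite !costE // lee_fin => le; rewrite leqNgt; apply/negP => xY.
by move: le; rewrite leNgt renewal_cost_increasing.
Qed.
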